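(* Fix $k \in \mathbb{N}$. For each $m$ let $X^{(m)}_1,\dots,X^{(m)}_k$ be multisets of samples from the proposal density $q$ such that, for every $m$ and $i$, the samples in $X^{(m)}_i$ are iid from $q$. Let $X^{(m)}_\cup = \bigcup_{i=1}^k X^{(m)}_i$ be the multiset union (counted with multiplicity), whose samples may be dependent, and suppose that $m = |X^{(m)}_\cup|$ and that $|X^{(m)}_i| \to \infty$ as $m\to\infty$ for each $i$. Let $H=\int f(x)h(x)\,\mathrm{d}x$, and let $\widehat{\mathfrak{I}}$ be either the Importance Sampling estimator $\mathfrak{I}$ or the self-normalized Importance Sampling estimator $\mathfrak{I}_{\mathrm{n}}$. Then the sequence of estimates $\widehat{\mathfrak{I}}(X^{(m)}_\cup)$ for $m\to\infty$ is consistent, i.e. $$\lim_{m\to\infty} \mathbb{P}\bigl( \| \widehat{\mathfrak{I}}(X^{(m)}_\cup) - H \| \ge \varepsilon \bigr) = 0 \quad\text{for all } \varepsilon>0 .$$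
   Context: $f$ is the target probability density, $q$ is the proposal probability density, and $h$ is an $\mathbb{R}^d$-valued measurable function whose mean $H=\mathbb{E}_f(h(x))=\int f(x)h(x)\,\mathrm{d}x$ exists ($\int f(x)\|h(x)\|\,\mathrm{d}x<\infty$); $\|\cdot\|$ is a norm on $\mathbb{R}^d$. It is assumed that $q(x)>0$ whenever $f(x)h(x)\neq 0$; for the self-normalized estimator, it is assumed that $q(x)>0$ whenever $f(x)>0$. The sizes $|X^{(m)}_i|$ are deterministic; $|X|$ denotes cardinality counted with multiplicity. No assumption is made on the joint dependence between samples from different $X^{(m)}_i$. Importance Sampling estimator: $\mathfrak{I}(X) = \frac{1}{|X|}\sum_{x\in X} w(x)h(x)$, with weight function $w(x)=f(x)/q(x)$. Self-normalized Importance Sampling estimator (used when $f$ is known only up to a constant): $\mathfrak{I}_{\mathrm{n}}(X) = \frac{1}{w_\Sigma(X)}\sum_{x\in X} w_u(x)h(x)$, where $w_u(x)=\tilde f(x)/q(x)$, $\tilde f = c f$ for some (unknown) constant $c>0$ is the unnormalized target, and $w_\Sigma(X)=\sum_{x\in X} w_u(x)$; when $w_\Sigma(X)=0$ set $\mathfrak{I}_{\mathrm{n}}(X)=0$. Sums over $x\in X$ are taken with multiplicity. *)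

(* Defs.v *)
From mathcomp Require Export all_boot all_order all_algebra.
From mathcomp Require Export all_classical all_reals all_analysis.

Set Implicit Arguments.
Unset Strict Implicit.
Unset Printing Implicit Defensive.

Import Order.TTheory GRing.Theory Num.Theory.

Local Open Scope classical_set_scope.
Local Open Scope ring_scope.

(* R^d is 'rV[R]_d; the canonical norm of this type in the library is the sup
   norm, so an arbitrary norm on R^d is a function satisfying the axioms. *)
Record is_norm (R : realType) (d : nat) (N : 'rV[R]_d -> R) : Prop := IsNorm {
  is_norm_triangle : forall u v, N (u + v) <= N u + N v ;
  is_norm_scale : forall (a : R) u, N (a *: u) = `|a| * N u ;
  is_norm_eq0 : forall u, N u = 0 -> u = 0
}.

Record is_density (R : realType) (dT : measure_display) (T : measurableType dT)
    (mu : {measure set T -> \bar R}) (p : T -> R) : Prop := IsDensity {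
  is_density_measurable : measurable_fun [set: T] p ;
  is_density_ge0 : forall x, 0 <= p x ;
  is_density_int1 : (\int[mu]_x (p x)%:E = 1)%E
}.

Definition has_density (R : realType) (dO dT : measure_display)
    (Omega : measurableType dO) (T : measurableType dT) (P : probability Omega R)
    (mu : {measure set T -> \bar R}) (Y : {mfun Omega >-> T}) (q : T -> R) : Prop :=
  forall A : set T, measurable A ->
    distribution P Y A = (\int[mu]_(x in A) (q x)%:E)%E.

Definition mutually_independent (R : realType) (dO dT : measure_display)
    (Omega : measurableType dO) (T : measurableType dT) (P : probability Omega R)
    (I : finType) (Y : I -> {mfun Omega >-> T}) : Prop :=
  forall (J : {set I}) (A : I -> set T),
    (forall i, i \in J -> measurable (A i)) ->
    P (\bigcap_(i in [set` J]) (Y i @^-1` A i)) =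
    (\prod_(i in J) P (Y i @^-1` A i))%E.

Definition iid_from (R : realType) (dO dT : measure_display)
    (Omega : measurableType dO) (T : measurableType dT) (P : probability Omega R)
    (mu : {measure set T -> \bar R}) (q : T -> R)
    (I : finType) (Y : I -> {mfun Omega >-> T}) : Prop :=
  mutually_independent P Y /\ forall i, has_density P mu (Y i) q.

(* Finite multisets are represented by sequences; the estimators below do not
   depend on the order of their elements. Since x / 0 = 0, the weight is 0
   where q vanishes, which has probability 0 under q. *)
Definition importance_weight (R : realType) (T : Type) (f q : T -> R) (x : T) : R :=
  f x / q x.

Definition importance_estimator (R : realType) (T : Type) (d : nat) (f q : T -> R)
    (h : T -> 'rV[R]_d) (X : seq T) : 'rV[R]_d :=
  (size X)%:R^-1 *: \sum_(x <- X) importance_weight f q x *: h x.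

Definition weight_sum (R : realType) (T : Type) (fu q : T -> R) (X : seq T) : R :=
  \sum_(x <- X) importance_weight fu q x.

Definition self_normalized_estimator (R : realType) (T : Type) (d : nat) (fu q : T -> R)
    (h : T -> 'rV[R]_d) (X : seq T) : 'rV[R]_d :=
  if weight_sum fu q X == 0 then 0
  else (weight_sum fu q X)^-1 *:
         \sum_(x <- X) importance_weight fu q x *: h x.

(* Realisation at w of the multiset union of k families of samples, the i-th
   of size n i. *)
Definition sample_union (Omega T : Type) (k : nat) (n : 'I_k -> nat)
    (X : forall i : 'I_k, 'I_(n i) -> Omega -> T) (w : Omega) : seq T :=
  [seq X i j w | i <- enum 'I_k, j <- enum 'I_(n i)].

Definition consistent (R : realType) (dO : measure_display)
    (Omega : measurableType dO) (P : probability Omega R) (d : nat)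
    (N : 'rV[R]_d -> R) (Y : nat -> Omega -> 'rV[R]_d) (H : 'rV[R]_d) : Prop :=
  forall eps : R, 0 < eps ->
    P [set w | eps <= N (Y m w - H)] @[m --> \oo] --> (0 : \bar R)%E.

(* Main.v *)
(** A weak law of large numbers in L^1, uniform over all iid families of size
    at least n: by a variance computation it holds for indicators, hence for
    simple functions by linearity, hence for integrable functions since the L^1
    error of a sample mean is at most the L^1 distance of the integrands.
    Because it is an L^1 statement, it passes by convexity from the blocks to
    their union, however dependent the blocks are. Applied to the importance
    weights [f / q] times a coordinate of [h], it yields the consistency of
    importance sampling through Markov's inequality. The self-normalized
    estimator is the quotient of the importance sampling estimators of [h] and
    of the constant 1, and the latter tends to 1 in probability. *)

Require Import Defs.
From mathcomp Require Import measurable_realfun ring lra.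

Set Implicit Arguments.
Unset Strict Implicit.
Unset Printing Implicit Defensive.

Import Order.TTheory GRing.Theory Num.Theory.
Import numFieldNormedType.Exports.

Local Open Scope classical_set_scope.
Local Open Scope ring_scope.

(** * Arbitrary norms on R^d: equivalence with the sup norm, and measurability *)

Section norm.
Context (R : realType) (d : nat) (N : 'rV[R]_d -> R).
Hypothesis normN : is_norm N.

Lemma is_norm0 : N 0 = 0.
Proof. by rewrite -(scale0r 0) (is_norm_scale normN) normr0 mul0r. Qed.

Lemma is_normN u : N (- u) = N u.
Proof. by rewrite -scaleN1r (is_norm_scale normN) normrN1 mul1r. Qed.

Lemma is_norm_ge0 u : 0 <= N u.
Proof.
have := is_norm_triangle normN u (- u).
by rewrite subrr is_norm0 is_normN -mulr2n pmulrn_lge0.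
Qed.

Lemma is_norm_sub u v : `|N u - N v| <= N (u - v).
Proof.
have := is_norm_triangle normN (u - v) v; rewrite subrK => ?.
have := is_norm_triangle normN (v - u) u; rewrite subrK -opprB is_normN => ?.
by rewrite ler_norml; apply/andP; split; lra.
Qed.

Lemma is_norm_sum (I : Type) (s : seq I) (u : I -> 'rV[R]_d) :
  N (\sum_(i <- s) u i) <= \sum_(i <- s) N (u i).
Proof.
elim/big_ind2 : _ => //; first by rewrite is_norm0.
by move=> a b u' v' ? ?; rewrite (le_trans (is_norm_triangle normN _ _)) ?lerD.
Qed.

Lemma is_norm_le_coord u :
  N u <= \sum_j `|u 0 j| * N (delta_mx 0 j).
Proof.
rewrite {1}(row_sum_delta u) (le_trans (is_norm_sum _ _))// ler_sum// => j _.
by rewrite (is_norm_scale normN).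
Qed.

Lemma coord_le_norm (u : 'rV[R]_d) j : `|u 0 j| <= `|u|.
Proof.
rewrite [in leRHS]/Num.norm/= mx_normrE; apply/bigmax_geP.
by right; exists (0, j).
Qed.

Lemma is_norm_le_sup : exists2 C, 0 < C & forall u, N u <= C * `|u|.
Proof.
(* The summand 1 keeps the constant positive even when [d = 0]. *)
exists (1 + \sum_j N (delta_mx 0 j)) => [|u].
  by rewrite ltr_pwDl// sumr_ge0// => *; exact: is_norm_ge0.
rewrite (le_trans (is_norm_le_coord u))// mulrDl mul1r mulr_suml.
rewrite -[leLHS]add0r lerD// ler_sum// => j _.
by rewrite mulrC ler_wpM2l ?is_norm_ge0 ?coord_le_norm.
Qed.

(** The reverse triangle inequality and the domination by the sup norm make [N] Lipschitz. *)
Lemma is_norm_continuous : continuous N.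
Proof.
have [C C0 NC] := is_norm_le_sup.
move=> u; apply/(@cvgrPdist_le _ _ _ _ (nbhs_filter u)) => e e0.
apply/(@nbhs_normP R ('rV[R]_d : normedModType R) u); exists (e / C) => /=.
  by rewrite divr_gt0.
move=> v /ltW /= uv.
by rewrite (le_trans (is_norm_sub _ _))// (le_trans (NC _))// -ler_pdivlMl// mulrC.
Qed.

(* The continuous function N attains a positive minimum on the unit sphere of
   the sup norm. *)
Lemma sup_le_is_norm : exists2 C, 0 < C & forall u, `|u| <= C * N u.
Proof.
pose S := [set u : 'rV[R]_d | `|u| = 1].
(* The sphere is empty when [d = 0]. Normalizing a nonzero vector would give a point of it, so every
   vector is then 0. *)
have [S0|/set0P Sn0] := eqVneq S set0.
  exists 1 => // u; rewrite mul1r.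
  have [->|u0] := eqVneq u 0; first by rewrite normr0 is_norm_ge0.
  suff : S (`|u|^-1 *: u) by rewrite S0.
  by rewrite /S/= normrZ normfV normr_id mulVf// normr_eq0.
have cS : compact S.
  apply: bounded_closed_compact.
    exists 1; split => // M M1 u; rewrite /S/= => ->; exact: ltW.
  rewrite (_ : S = Num.norm @^-1` [set 1])//.
  apply: preimage_closed; last exact: (@closed_eq R 1).
  by move=> u _; exact: norm_continuous.
have cN : {within S, continuous N}.
  exact/continuous_subspaceT/is_norm_continuous.
have [c /set_mem cS1 Nc] := EVT_min_rV Sn0 cS cN.
have Nc0 : 0 < N c.
  rewrite lt_neqAle is_norm_ge0 andbT eq_sym; apply/eqP => /(is_norm_eq0 normN) c0.
  by move: cS1; rewrite /S/= c0 normr0 => /esym/eqP; rewrite oner_eq0.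
exists (N c)^-1; rewrite ?invr_gt0// => u.
have [->|u0] := eqVneq u 0; first by rewrite normr0 mulr_ge0 ?invr_ge0 ?is_norm_ge0.
have nu0 : 0 < `|u| by rewrite normr_gt0.
have := Nc (`|u|^-1 *: u); rewrite inE (is_norm_scale normN) ger0_norm ?invr_ge0//.
rewrite /S/= normrZ normfV normr_id mulVf ?gt_eqF// => /(_ erefl).
by rewrite ler_pdivlMl// ler_pdivlMl// mulrC.
Qed.

(** Only the coordinates of [Y] are known to be measurable. By continuity of [N], each set where
    [N (Y w) < x] is a countable union of events that [Y w] lies in a box with rational centre and
    radius [1 / (n + 1)]; such an event involves finitely many coordinates. *)
Lemma measurable_is_norm (dO : measure_display) (Omega : measurableType dO)
    (Y : Omega -> 'rV[R]_d) :
  (forall j, measurable_fun [set: Omega] (fun w => Y w 0 j)) ->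
  measurable_fun [set: Omega] (N \o Y).
Proof.
move=> mY.
have [C C0 NC] := is_norm_le_sup.
pose box (r : 'rV[rat]_d * nat) :=
  \bigcap_(j in [set: 'I_d])
    [set w | `|Y w 0 j - ratr (r.1 0 j)| < r.2.+1%:R^-1].
have mbox r : measurable (box r).
  rewrite /box -(setCK (\bigcap_(j in _) _)) setC_bigcap.
  apply/measurableC/countable_bigcupT_measurable => // j; apply: measurableC.
  have mD : measurable_fun [set: Omega] (fun w => `|Y w 0 j - ratr (r.1 0 j)|).
    by apply: measurableT_comp => //; apply: measurable_funB => //; exact: mY.
  have := mD measurableT _ (measurable_itv `]-oo, r.2.+1%:R^-1[).
  by rewrite setTI; congr measurable; apply/seteqP; split=> w; rewrite /= in_itv.
have box_dist r w : box r w -> `|Y w - map_mx ratr r.1| <= r.2.+1%:R^-1.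
  move=> bw; rewrite [leLHS]/Num.norm/= mx_normrE.
  apply/bigmax_leP; split=> [|[i j] _]; first by rewrite invr_ge0.
  by rewrite !mxE (ord1 i) ltW//; exact: bw.
apply: (measurability _ (@RGenInftyO.measurableE R)) => // _ [_ [x ->] <-].
rewrite setTI; set A := (X in measurable X).
suff -> : A = \bigcup_r
    (if N (map_mx ratr r.1) + C / r.2.+1%:R < x then box r else set0).
  by apply: countable_bigcupT_measurable => // r; case: ifP.
have NB u v : N u <= N v + C * `|u - v|.
  by rewrite -lerBlDl (le_trans _ (NC _))// (le_trans _ (is_norm_sub _ _))// ler_norm.
apply/seteqP; split=> [w|w [r _]]; rewrite /A/= in_itv/=; last first.
  case: ifP => // rx bw; rewrite (le_lt_trans _ rx)// (le_trans (NB _ (map_mx ratr r.1)))//.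
  by rewrite lerD2l ler_wpM2l ?(ltW C0)// box_dist.
(* This picks [n] with [N (Y w) + 2 * C / (n + 1) < x]: one share [C / (n + 1)] pays for replacing
   [Y w] by a rational centre, the other for the margin that the union demands of a box. *)
rewrite -(@ltr_pM2r _ (2 * C)^-1) ?invr_gt0 ?mulr_gt0// => /ltr_add_invr[n].
rewrite -(@ltr_pM2r _ (2 * C)) ?mulr_gt0// mulfVK ?gt_eqF ?mulr_gt0// => Nx.
have /choice[r rY] j : exists r : rat, `|Y w 0 j - ratr r| < n.+1%:R^-1.
  have [|r] := @rat_in_itvoo R (Y w 0 j - n.+1%:R^-1) (Y w 0 j + n.+1%:R^-1).
    by rewrite ltrBlDr -addrA ltrDl addr_gt0// invr_gt0.
  by rewrite in_itv/= => /andP[a b]; exists r; rewrite ltr_norml; apply/andP;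
    split; set e := _%:R^-1 in a b *; lra.
have bw : box (\row_j r j, n) w by move=> j _ /=; rewrite mxE.
exists (\row_j r j, n) => //; case: ifPn => //; rewrite -leNgt => xr; exfalso.
move: Nx; apply/negP; rewrite -leNgt (le_trans xr)//=.
rewrite (le_trans (lerD (NB _ (Y w)) (lexx _)))// distrC.
have := box_dist _ _ bw => /(ler_wpM2l (ltW C0))/= bC.
rewrite mulrDl mulfVK ?gt_eqF ?mulr_gt0//.
set e := _%:R^-1 in bC *; lra.
Qed.
End norm.

(** * Integration against a measure with a density: nonnegative functions *)

Section density.
Context (R : realType) (dT : measure_display) (T : measurableType dT).
Context (mu nu : {measure set T -> \bar R}) (q : T -> R).
Hypotheses (mq : measurable_fun [set: T] q) (q0 : forall x, 0 <= q x).
Hypothesis nuq : forall A, measurable A -> nu A = (\int[mu]_(x in A) (q x)%:E)%E.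

Import HBNNSimple.

(** The hypothesis [nuq] is the case of indicators. Linearity extends it to simple functions, and
    monotone convergence on both sides to their increasing limits. *)
Lemma ge0_integral_density (phi : T -> R) :
  measurable_fun [set: T] phi -> (forall x, 0 <= phi x) ->
  (\int[nu]_x (phi x)%:E = \int[mu]_x (phi x * q x)%:E)%E.
Proof.
move=> mphi phi0.
have mEphi : measurable_fun [set: T] (fun x => (phi x)%:E) by exact/measurable_EFinP.
pose g := nnsfun_approx measurableT mEphi.
have g_cvg x : (g n x)%:E @[n --> \oo] --> (phi x)%:E.
  by apply: cvg_nnsfun_approx => //= y _; rewrite lee_fin.
have g_nd x : nondecreasing_seq (fun n => g n x).
  by move=> a b ab; exact/lefP/nd_nnsfun_approx.
have eqg n : (\int[nu]_x (g n x)%:E = \int[mu]_x (g n x * q x)%:E)%E.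
  rewrite integralT_nnsfun sintegralE.
  transitivity (\int[mu]_x (\sum_(r \in range (g n))
      (r * (\1_(g n @^-1` [set r]) x * q x))%:E))%E; last first.
    apply: eq_integral => x _; rewrite fsumEFin//; congr EFin.
    rewrite (fimfunE (g n)) !fsbig_finite// big_distrl/=.
    by apply: eq_bigr => r _; rewrite mulrA.
  rewrite ge0_integral_fsum//; last 2 first.
  - by move=> r; apply/measurable_EFinP; do 2 apply: measurable_funM => //.
  - move=> r x _; rewrite mulrA EFinM mule_ge0 ?lee_fin//.
    exact: nnfun_muleindic_ge0.
  (* Only levels attained by [g n] occur, so [r] is nonnegative and may leave the integral. *)
  apply: eq_fsbigr => r /set_mem [x _ gxr].
  have r0 : 0 <= r by rewrite -gxr.
  have mA : measurable (g n @^-1` [set r]) by [].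
  under [RHS]eq_integral do rewrite EFinM.
  rewrite ge0_integralZl_EFin//; last 2 first.
  - by move=> y _; rewrite lee_fin mulr_ge0.
  - exact/measurable_EFinP/measurable_funM.
  rewrite nuq//; congr *%E; rewrite integral_mkcond.
  apply: eq_integral => y _; rewrite patchE indicE.
  by case: ifPn; rewrite ?mul1r ?mul0r.
transitivity (limn (fun n => \int[nu]_x (g n x)%:E))%E.
  rewrite -monotone_convergence//.
  - by apply: eq_integral => x _; apply/esym/cvg_lim => //; exact: g_cvg.
  - by move=> n; exact/measurable_EFinP/measurable_funP.
  - by move=> n y _; rewrite lee_fin.
  - by move=> y _ a b ab; rewrite lee_fin; exact: g_nd.
under eq_fun do rewrite eqg.
rewrite -monotone_convergence//.
- apply: eq_integral => x _; apply/cvg_lim => //.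
  under eq_fun do rewrite EFinM.
  by rewrite EFinM; apply: cvgeZr.
- by move=> n; apply/measurable_EFinP/measurable_funM.
- by move=> n y _; rewrite lee_fin mulr_ge0.
- by move=> y _ a b ab; rewrite lee_fin ler_wpM2r// g_nd.
Qed.
End density.

(** * The uniform weak law of large numbers in L^1 *)

Section weak_law.
Context (R : realType) (dO dT : measure_display).
Context (Omega : measurableType dO) (T : measurableType dT).
Context (P : probability Omega R) (nu : probability T R).

Definition iid_sample n (Y : 'I_n -> {mfun Omega >-> T}) : Prop :=
  mutually_independent P Y /\
  forall i A, measurable A -> distribution P (Y i) A = nu A.

Definition sample_mean (phi : T -> R) n (Y : 'I_n -> Omega -> T) (w : Omega) : R :=
  n%:R^-1 * \sum_j phi (Y j w).

Lemma measurable_sample_mean phi n (Y : 'I_n -> {mfun Omega >-> T}) :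
  measurable_fun [set: T] phi ->
  measurable_fun [set: Omega] (sample_mean phi (fun j => Y j)).
Proof.
move=> mphi; apply: measurable_funM => //.
by apply: measurable_sum => j; exact: measurableT_comp.
Qed.

(** The threshold [n0] is chosen before the family [Y]. This matters because the samples form a
    triangular array: a block at stage [m + 1] need not extend the block at stage [m]. *)
Definition uniform_weak_law (phi : T -> R) : Prop :=
  forall eps : R, 0 < eps -> exists n0, forall n, (n0 <= n)%N ->
  forall Y : 'I_n -> {mfun Omega >-> T}, iid_sample Y ->
  (\int[P]_w `|sample_mean phi (fun j => Y j) w - (\int[nu]_x phi x)%R|%:E
    <= eps%:E)%E.

(** These are the second moments for the variance of an empirical frequency; off the diagonal,
    independence is used for the index set [{i, j}] only. *)
Lemma iid_sample_pair n (Y : 'I_n -> {mfun Omega >-> T}) A (i j : 'I_n) :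
  iid_sample Y -> measurable A ->
  P (Y i @^-1` A `&` Y j @^-1` A) =
    (if i == j then nu A else nu A * nu A)%E.
Proof.
move=> [indY nuY] mA; have [->|ij] := eqVneq i j; first by rewrite setIid -(nuY j).
have := indY [set i; j]%SET (fun=> A) (fun _ _ => mA).
rewrite (_ : \bigcap_(_ in _) _ = Y i @^-1` A `&` Y j @^-1` A); last first.
  apply/seteqP; split=> [w Yw|w [Yi Yj] l /=].
    by split; apply: Yw; rewrite /= !inE eqxx ?orbT.
  by rewrite !inE => /orP[] /eqP ->.
move=> ->; rewrite big_setU1 ?inE//= big_set1 -{1}(nuY i)// -(nuY j)//.
Qed.

(** The variance of the sample mean is at most [1 / n], and the inequality
    [|z| <= eps / 2 + 2 / eps * z ^+ 2] turns this second moment into an L^1 bound. *)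
Lemma uniform_weak_law_indic A : measurable A -> uniform_weak_law \1_A.
Proof.
move=> mA eps eps0.
have -> : (\int[nu]_x \1_A x)%R = fine (nu A).
  by rewrite /Rintegral integral_indic// setIT.
set p := fine (nu A).
have pE : nu A = p%:E by rewrite fineK// fin_num_measure.
have p0 : 0 <= p by rewrite fine_ge0.
(* Chosen so that [1 / n <= eps ^+ 2 / 4], whence [2 / eps] times the variance is at most
   [eps / 2]. *)
pose n0 := (Num.truncn (4 / eps ^+ 2)).+1.
exists n0 => n n0n Y iidY.
have n_gt0 : 0 < n%:R :> R by rewrite ltr0n (leq_trans _ n0n).
have nl : n%:R^-1 <= eps ^+ 2 / 4.
  rewrite -[leRHS]invrK lef_pV2 ?posrE ?invr_gt0 ?divr_gt0 ?exprn_gt0//.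
  rewrite invf_div (le_trans (ltW (truncnS_gt _)))// ler_nat; exact: n0n.
(* This is the product of the two centred indicators, expanded and grouped as a difference of
   nonnegative functions. Its mean is [p - p ^+ 2 <= 1] on the diagonal and 0 elsewhere. *)
pose t (ij : 'I_n * 'I_n) w : R :=
  (\1_(Y ij.1 @^-1` A `&` Y ij.2 @^-1` A) w + p ^+ 2) -
  (p * \1_(Y ij.1 @^-1` A) w + p * \1_(Y ij.2 @^-1` A) w).
have mY i : measurable (Y i @^-1` A) by exact: measurable_funPTI.
have PY i : (P : {measure set Omega -> \bar R}) (Y i @^-1` A) = p%:E.
  by rewrite -pE -(iidY.2 i).
have PYY i j : (P : {measure set Omega -> \bar R}) (Y i @^-1` A `&` Y j @^-1` A) =
    (if i == j then p else p * p)%:E.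
  by move: (iid_sample_pair i j iidY mA); rewrite pE -EFinM; case: ifP.
have it1 ij : P.-integrable setT (fun w =>
    (\1_(Y ij.1 @^-1` A `&` Y ij.2 @^-1` A) w + p ^+ 2)%:E).
  under eq_fun do rewrite EFinD.
  apply: integrableD => //; first by apply: integrable_indic => //; exact: measurableI.
  exact: finite_measure_integrable_cst.
have it2 ij : P.-integrable setT (fun w =>
    (p * \1_(Y ij.1 @^-1` A) w + p * \1_(Y ij.2 @^-1` A) w)%:E).
  under eq_fun do rewrite EFinD !EFinM.
  by apply: integrableD => //; apply: integrableZl => //; exact: integrable_indic.
have it ij : P.-integrable setT (fun w => (t ij w)%:E).
  by under eq_fun do rewrite EFinB; exact: integrableB.
have Et ij : (\int[P]_w (t ij w)%:E <= (ij.1 == ij.2)%:R%:E)%E.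
  under eq_integral do rewrite EFinB.
  rewrite integralB//.
  under eq_integral do rewrite EFinD.
  rewrite ge0_integralD//; last 2 first.
  - by apply/measurable_EFinP; apply: measurable_indic; exact: measurableI.
  - by move=> *; rewrite lee_fin exprn_ge0.
  rewrite integral_indic//; last exact: measurableI.
  rewrite setIT integral_cst// [X in (_ * X)%E](probability_setT P) mule1.
  under [X in (_ - X)%E]eq_integral do rewrite EFinD !EFinM.
  rewrite ge0_integralD//; last 4 first.
  - by move=> *; rewrite mule_ge0 ?lee_fin.
  - by apply/measurable_EFinP; apply: measurable_funM.
  - by move=> *; rewrite mule_ge0 ?lee_fin.
  - by apply/measurable_EFinP; apply: measurable_funM.
  rewrite !ge0_integralZl_EFin//; try by apply/measurable_EFinP.
  rewrite !integral_indic// !setIT !PY PYY.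
  have : p <= 1 by rewrite -lee_fin -pE probability_le1.
  case: eqP => _ p1; rewrite -!EFinM -!EFinD -?EFinN -?EFinD lee_fin/=; nra.
(* The bound comes from expanding the square of [|z| - eps / 2]; the double sum of the [t ij w] is
   [n ^+ 2 * z ^+ 2]. *)
have sq w : `|sample_mean \1_A (fun j => Y j) w - p| <= eps / 2 +
    \sum_ij (2 / eps * (n%:R^-1 * n%:R^-1) * t ij w).
  set z := _ - p.
  have -> : \sum_ij (2 / eps * (n%:R^-1 * n%:R^-1) * t ij w) = 2 / eps * z ^+ 2.
    rewrite -mulr_sumr -mulrA; congr (_ * _).
    have -> : z = n%:R^-1 * \sum_j (\1_A (Y j w) - p).
      rewrite /z /sample_mean sumrB sumr_const card_ord mulrBr.
      by rewrite -[p *+ n]mulr_natl mulKf ?gt_eqF.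
    rewrite exprMn -expr2; congr (_ * _).
    rewrite expr2 big_distrlr/= pair_big/=; apply: eq_bigr => -[i j] _.
    have e l : \1_(Y l @^-1` A) w = \1_A (Y l w) :> R by [].
    rewrite /t/= indicI/= !e; ring.
  have : 0 <= (`|z| - eps / 2) ^+ 2 by exact: sqr_ge0.
  rewrite sqrrB -[z ^+ 2]real_normK ?num_real// => h.
  rewrite -lerBlDl -ler_pdivrMl ?divr_gt0// invf_div.
  have := normr_ge0 z; nra.
set c := 2 / eps * (n%:R^-1 * n%:R^-1) in sq.
have c0 : 0 <= c by rewrite !mulr_ge0 ?invr_ge0 ?(ltW eps0).
have isum : P.-integrable setT (fun w => \sum_ij c%:E * (t ij w)%:E)%E.
  by apply: integrable_sum => // ij _; exact: integrableZl.
apply: (@le_trans _ _ (\int[P]_w ((eps / 2)%:E + \sum_ij c%:E * (t ij w)%:E))%E).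
  apply: ge0_le_integral => //.
  - apply/measurable_EFinP; apply: measurableT_comp => //.
    by apply: measurable_funB => //; exact/measurable_sample_mean/measurable_indic.
  - by apply: emeasurable_funD => //; exact: measurable_int isum.
  - move=> w _; under eq_bigr do rewrite -EFinM.
    by rewrite sumEFin -EFinD lee_fin.
rewrite integralD//; last exact: finite_measure_integrable_cst.
rewrite integral_cst// [X in (_ * X)%E](probability_setT P) mule1.
rewrite integral_sum//; last by move=> ij; exact: integrableZl.
under eq_bigr do rewrite integralZl//.
apply: (@le_trans _ _ ((eps / 2)%:E +
  \sum_(ij : 'I_n * 'I_n) (c * (ij.1 == ij.2)%:R)%:E)%E).
  rewrite leeD2l//; apply: lee_sum => ij _; rewrite (EFinM c).
  by apply: lee_wpmul2l => //; rewrite lee_fin.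
rewrite sumEFin -EFinD lee_fin -mulr_sumr.
(* Only the [n] diagonal pairs count, which leaves [2 / eps / n]. *)
rewrite -(pair_big xpredT xpredT (fun i j : 'I_n => (i == j)%:R))/=.
have -> : \sum_(i < n) (\sum_j (i == j)%:R) = n%:R :> R.
  rewrite -[n in RHS]card_ord -sumr_const; apply: eq_bigr => i _.
  by rewrite (bigD1 i)//= eqxx big1 ?addr0// => j; rewrite eq_sym => /negPf ->.
rewrite /c -!mulrA mulVf ?gt_eqF// mulr1.
have := nl; rewrite -(ler_pM2l (x := 2 / eps)) ?divr_gt0//.
have -> : 2 / eps * (eps ^+ 2 / 4) = eps / 2 by field; rewrite gt_eqF.
lra.
Qed.


Lemma uniform_weak_law0 : uniform_weak_law (cst 0).
Proof.
move=> eps eps0; exists 0%N => n _ Y _.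
rewrite (eq_integral (cst 0%E)) ?integral0 ?lee_fin ?ltW// => w _.
by rewrite /sample_mean big1// mulr0 Rintegral_cst// mul0r subrr normr0.
Qed.

Lemma uniform_weak_lawD a phi psi :
  nu.-integrable setT (EFin \o phi) -> nu.-integrable setT (EFin \o psi) ->
  uniform_weak_law phi -> uniform_weak_law psi ->
  uniform_weak_law (fun x => a * phi x + psi x).
Proof.
move=> iphi ipsi lphi lpsi eps eps0.
have mphi : measurable_fun [set: T] phi by exact/measurable_EFinP/(measurable_int nu).
have mpsi : measurable_fun [set: T] psi by exact/measurable_EFinP/(measurable_int nu).
(* Dividing by [|a| + 1] instead of [|a|] covers [a = 0]. *)
have a0 : 0 < `|a| + 1 by rewrite ltr_wpDl.
have [n1 {}lphi] := lphi (eps / 2 / (`|a| + 1)) ltac:(by rewrite !divr_gt0).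
have [n2 {}lpsi] := lpsi (eps / 2) ltac:(by rewrite !divr_gt0).
exists (maxn n1 n2) => n; rewrite geq_max => /andP[n1n n2n] Y iidY.
have {}lphi := lphi _ n1n _ iidY; have {}lpsi := lpsi _ n2n _ iidY.
have iaphi : nu.-integrable setT (EFin \o (fun x => a * phi x)).
  exact: (integrableZl measurableT a iphi).
rewrite RintegralD// RintegralZl//.
set c1 := (\int[nu]_x phi x)%R in lphi *; set c2 := (\int[nu]_x psi x)%R in lpsi *.
have mz f c : measurable_fun [set: T] f ->
    measurable_fun [set: Omega] (fun w => `|sample_mean f (fun j => Y j) w - c|%:E).
  move=> mf; apply/measurable_EFinP; apply: measurableT_comp => //.
  by apply: measurable_funB => //; exact: measurable_sample_mean.
apply: (@le_trans _ _ (\int[P]_w (`|a|%:E * `|sample_mean phi (fun j => Y j) w - c1|%:E +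
   `|sample_mean psi (fun j => Y j) w - c2|%:E))%E).
  apply: ge0_le_integral => //.
  - by apply: mz; apply: measurable_funD => //; exact: measurable_funM.
  - by apply: emeasurable_funD; [exact/measurable_funeM/mz|exact: mz].
  - move=> w _; rewrite -EFinM -EFinD lee_fin -normrM.
    rewrite (le_trans _ (ler_normD _ _))// le_eqVlt; apply/orP; left; apply/eqP.
    congr `|_|; rewrite /sample_mean big_split/= -mulr_sumr; ring.
rewrite ge0_integralD//; last 2 first.
- exact/measurable_funeM/mz.
- exact: mz.
rewrite ge0_integralZl_EFin//; last exact: mz.
rewrite (splitr eps) EFinD; apply: leeD lpsi.
apply: le_trans (lee_wpmul2l _ lphi) _; first by rewrite lee_fin.
rewrite -EFinM lee_fin.
by rewrite mulrCA ger_pMr ?divr_gt0// ler_pdivrMr// mul1r lerDl.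
Qed.

Import HBSimple.

Lemma uniform_weak_law_sfun (g : {sfun T >-> R}) : uniform_weak_law g.
Proof.
have [s gE] : exists s : seq R,
    g = (fun x => \sum_(y <- s) y * \1_(g @^-1` [set y]) x) :> (T -> R).
  exists (finmap.enum_fset (fset_set (range g))).
  by apply/funext => x; rewrite {1}fimfunE fsbig_finite.
rewrite {}gE.
(* The list [s] is now arbitrary, which permits induction on it; integrability is carried along
   because [uniform_weak_lawD] asks for it. *)
suff [] : nu.-integrable setT (EFin \o (fun x : T =>
    \sum_(y <- s) y * \1_(g @^-1` [set y]) x))
  /\ uniform_weak_law (fun x => \sum_(y <- s) y * \1_(g @^-1` [set y]) x) by [].
elim: s => [|y s [int_s ls]].
  by under eq_fun do rewrite big_nil; split; [exact: integrable0|exact: uniform_weak_law0].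
have iy : nu.-integrable setT (EFin \o \1_(g @^-1` [set y])) by exact: integrable_indic.
under eq_fun do rewrite big_cons; split.
  exact: (integrableD measurableT (integrableZl measurableT y iy) int_s).
by apply: uniform_weak_lawD => //; exact: uniform_weak_law_indic.
Qed.

Lemma weak_law_L1 phi :
  nu.-integrable setT (EFin \o phi) -> uniform_weak_law phi.
Proof.
move=> iphi eps eps0.
have mphi : measurable_fun [set: T] phi by exact/measurable_EFinP/(measurable_int nu).
(* The three shares go to the sample mean of [|phi - g|], to the law for the simple function [g],
   and to the gap between the integrals of [phi] and [g]. *)
have e3 : 0 < eps / 3 by rewrite divr_gt0.
have [g_ [ig _]] := approximation_sfun_integrable measurableT iphi.
move=> /fine_cvgP[_] /cvgrPdist_le /(_ _ e3) [n1 _ /(_ _ (leqnn n1)) /=].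
set g := g_ n1 => gphi.
have mg : measurable_fun [set: T] g by exact/measurable_EFinP/(measurable_int nu)/ig.
pose r x := phi x - g x.
have ir : nu.-integrable setT (EFin \o r) by exact: (integrableB measurableT iphi (ig n1)).
have mr : measurable_fun [set: T] r by exact: measurable_funB.
have r_eps : (\int[nu]_x `|r x|%:E <= (eps / 3)%:E)%E.
  rewrite -[leLHS]fineK; last by apply: integrable_fin_num => //; exact: integrable_norm.
  by move: gphi; rewrite lee_fin sub0r normrN => /(le_trans (ler_norm _)).
have c_eps : `|(\int[nu]_x phi x)%R - (\int[nu]_x g x)%R| <= eps / 3.
  rewrite -RintegralB//; last exact: ig.
  apply: le_trans (le_normr_Rintegral _ ir) _ => //.
  rewrite -lee_fin (le_trans _ r_eps)// /Rintegral fineK//.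
  by apply: integrable_fin_num => //; exact: integrable_norm.
have [n2 {}lg] := @uniform_weak_law_sfun g _ e3.
(* The 1 excludes the empty sample, for which [n^-1 * n] would not cancel. *)
exists (maxn 1 n2) => n; rewrite geq_max => /andP[n0 n2n] Y iidY.
have {}lg := lg _ n2n _ iidY.
set c := (\int[nu]_x phi x)%R in c_eps *; set cg := (\int[nu]_x g x)%R in lg c_eps.
have mrY (j : 'I_n) : measurable_fun [set: Omega] (fun w => `|r (Y j w)|%:E).
  by apply/measurable_EFinP; apply: measurableT_comp => //; exact: measurableT_comp.
have mz f e : measurable_fun [set: T] f ->
    measurable_fun [set: Omega] (fun w => `|sample_mean f (fun j => Y j) w - e|%:E).
  move=> mf; apply/measurable_EFinP; apply: measurableT_comp => //.
  by apply: measurable_funB => //; exact: measurable_sample_mean.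
(* Every [Y j] has law [nu], so each term has the mean of [|r|] under [nu], and linearity
   suffices. *)
have ErY : (\int[P]_w (n%:R^-1%:E * \sum_(j < n) `|r (Y j w)|%:E) <= (eps / 3)%:E)%E.
  rewrite ge0_integralZl_EFin//; last 2 first.
  - by move=> w _; exact: sume_ge0.
  - exact: emeasurable_sum.
  rewrite ge0_integral_sum//.
  apply: (@le_trans _ _ (n%:R^-1%:E * \sum_(j < n) (eps / 3)%:E))%E.
    apply: lee_wpmul2l; first by rewrite lee_fin invr_ge0.
    apply: lee_sum => j _; apply: le_trans r_eps.
    rewrite -(ge0_integral_distribution (Y j) (f := fun x => `|r x|%:E))//; last first.
      by apply/measurable_EFinP; exact: measurableT_comp.
    by rewrite (eq_measure_integral nu)// => A mA _; exact: iidY.2.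
  rewrite sumEFin -EFinM lee_fin sumr_const card_ord.
  by rewrite -[eps / 3 *+ n]mulr_natl mulKf// pnatr_eq0 -lt0n.
apply: (@le_trans _ _ (\int[P]_w (n%:R^-1%:E * \sum_(j < n) `|r (Y j w)|%:E +
    (`|sample_mean g (fun j => Y j) w - cg|%:E + (eps / 3)%:E)))%E).
  apply: ge0_le_integral => //.
  - exact: mz.
  - apply: emeasurable_funD; first exact/measurable_funeM/emeasurable_sum.
    by apply: emeasurable_funD => //; exact: mz.
  move=> w _; rewrite sumEFin -EFinM -!EFinD lee_fin.
  have -> : sample_mean phi (fun j => Y j) w - c =
      n%:R^-1 * (\sum_j r (Y j w)) +
      ((sample_mean g (fun j => Y j) w - cg) + (cg - c)).
    rewrite /r sumrB mulrBr /sample_mean; ring.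
  rewrite (le_trans (ler_normD _ _))// lerD//.
    by rewrite normrM ger0_norm ?invr_ge0// ler_wpM2l ?invr_ge0// ler_norm_sum.
  by rewrite (le_trans (ler_normD _ _))// lerD// distrC.
rewrite ge0_integralD//; last 4 first.
- by move=> w _; rewrite mule_ge0 ?lee_fin ?invr_ge0// sume_ge0.
- exact/measurable_funeM/emeasurable_sum.
- by move=> w _; rewrite -EFinD lee_fin addr_ge0 // ltW.
- by apply: emeasurable_funD => //; exact: mz.
rewrite ge0_integralD//; last 2 first.
- exact: mz.
- by move=> w _; rewrite lee_fin ltW.
rewrite integral_cst// [X in (_ * X)%E](probability_setT P) mule1.
rewrite [leRHS](_ : _ = (eps / 3)%:E + ((eps / 3)%:E + (eps / 3)%:E))%E.
  by rewrite leeD// leeD.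
by rewrite -!EFinD; congr EFin; field.
Qed.
End weak_law.

(** The inverse is expressed through a real power, known to be measurable; at 0 both sides of the
    identity are 0 by the convention [0^-1 = 0]. *)
Lemma measurable_invr (R : realType) : measurable_fun [set: R] (@GRing.inv R).
Proof.
have -> : @GRing.inv R = (fun x => x * (`|x| `^ (-1)) ^+ 2).
  apply/funext => x; rewrite powR_inv1// exprVn real_normK ?num_real//.
  by have [->|x0] := eqVneq x 0; [rewrite invr0 mul0r|field].
apply: measurable_funM => //; apply: measurable_funX.
by apply: (measurableT_comp (measurable_powR (-1))).
Qed.

(** * Integration against a density: signed functions and importance weights *)

Section density_integral.
Context (R : realType) (dT : measure_display) (T : measurableType dT).
Context (mu nu : {measure set T -> \bar R}) (q : T -> R).
Hypotheses (mq : measurable_fun [set: T] q) (q0 : forall x, 0 <= q x).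
Hypothesis nuq : forall A, measurable A -> nu A = (\int[mu]_(x in A) (q x)%:E)%E.

(** Since [q] is nonnegative, multiplication by it commutes with taking positive and negative parts,
    each of which is a nonnegative case. *)
Lemma integral_density (phi : T -> R) : measurable_fun [set: T] phi ->
  (\int[nu]_x (phi x)%:E = \int[mu]_x (phi x * q x)%:E)%E.
Proof.
move=> mphi; rewrite integralE [RHS]integralE.
have fposE psi : (fun x => (psi x)%:E : \bar R)^\+%E =
    (fun x => (Num.max (psi x) 0)%:E) :> (T -> \bar R).
  by apply/funext => x; rewrite funeposE EFin_max.
have fnegE psi : (fun x => (psi x)%:E : \bar R)^\-%E =
    (fun x => (Num.max (- psi x) 0)%:E) :> (T -> \bar R).
  by apply/funext => x; rewrite funenegE EFin_max EFinN.
have qmax x a : Num.max (a * q x) 0 = Num.max a 0 * q x.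
  by rewrite maxr_pMl// mul0r.
rewrite !fposE !fnegE; congr (_ - _)%E.
- rewrite (ge0_integral_density mq q0 nuq)//; last by move=> x; rewrite le_max lexx orbT.
    by apply: eq_integral => x _; rewrite qmax.
  exact: measurable_maxr.
- rewrite (ge0_integral_density mq q0 nuq)//; last by move=> x; rewrite le_max lexx orbT.
    by apply: eq_integral => x _; rewrite -mulNr qmax.
  by apply: measurable_maxr => //; exact: measurableT_comp.
Qed.

Lemma integrable_density (phi : T -> R) : measurable_fun [set: T] phi ->
  mu.-integrable setT (fun x => (phi x * q x)%:E) ->
  nu.-integrable setT (EFin \o phi).
Proof.
move=> mphi /integrableP[_ ifin]; apply/integrableP; split; first exact/measurable_EFinP.
under eq_integral do rewrite /comp/=.
rewrite (ge0_integral_density mq q0 nuq (phi := fun x => `|phi x|))//; last first.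
  exact: measurableT_comp.
apply: le_lt_trans ifin; rewrite le_eqVlt; apply/orP; left; apply/eqP.
by apply: eq_integral => x _; rewrite /= normrM (ger0_norm (q0 x)).
Qed.

(* The junk value [f x / q x = 0] at points where [q x = 0] is harmless since
   [f x * g x = 0] there. *)
Lemma importance_weight_integral (f g : T -> R) :
  measurable_fun [set: T] f -> measurable_fun [set: T] g ->
  mu.-integrable setT (fun x => (f x * g x)%:E) ->
  (forall x, f x * g x != 0 -> 0 < q x) ->
  nu.-integrable setT (fun x => (importance_weight f q x * g x)%:E) /\
  (\int[nu]_x (importance_weight f q x * g x) = \int[mu]_x (f x * g x))%R.
Proof.
move=> mf mg ifg fgq.
have mw : measurable_fun [set: T] (fun x => importance_weight f q x * g x).
  apply: measurable_funM => //; apply: measurable_funM => //.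
  exact: (measurableT_comp (@measurable_invr R)).
have wq : (fun x => importance_weight f q x * g x * q x) = (fun x => f x * g x).
  apply/funext => x; rewrite /importance_weight.
  have [fg0|/fgq qx] := eqVneq (f x * g x) 0; last by field; rewrite gt_eqF.
  have -> : f x / q x * g x * q x = f x * g x * ((q x)^-1 * q x) by ring.
  by rewrite fg0 mul0r.
split; first by apply: integrable_density => //; under eq_fun do rewrite (congr1 (@^~ _) wq).
by rewrite /Rintegral integral_density//; under eq_integral do rewrite (congr1 (@^~ _) wq).
Qed.

End density_integral.

Lemma ge0_cvge0 (R : realType) (u : nat -> \bar R) : (forall m, 0 <= u m)%E ->
  (forall eps : R, 0 < eps -> \forall m \near \oo, (u m <= eps%:E)%E) ->
  u m @[m --> \oo] --> (0 : \bar R)%E.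
Proof.
move=> u0 u_le.
have u_fin m (e : R) : (u m <= e%:E)%E -> u m \is a fin_num.
  by move=> ue; rewrite ge0_fin_numE// (le_lt_trans ue) ?ltry.
apply/fine_cvgP; split.
  (* The early terms may be infinite; the bound for [eps = 1] makes the terms finite eventually. *)
  by apply: filterS (u_le 1 ltr01) => m; exact: u_fin.
apply/cvgrPdist_le => e e0; apply: filterS (u_le e e0) => m ue /=.
by rewrite sub0r normrN ger0_norm ?fine_ge0// -lee_fin fineK// (u_fin _ e).
Qed.

(** * From the blocks to their union *)

Section pooled.
Context (R : realType) (dO dT : measure_display).
Context (Omega : measurableType dO) (T : measurableType dT).
Context (P : probability Omega R) (nu : probability T R).
Context (k : nat) (n : nat -> 'I_k -> nat).
Context (X : forall (m : nat) (i : 'I_k), 'I_(n m i) -> {mfun Omega >-> T}).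
Arguments X : clear implicits.
Hypothesis iidX : forall m i, iid_sample P nu (X m i).
Hypothesis sizeX : forall m, (\sum_(i < k) n m i)%N = m.
Hypothesis sizeX_oo : forall i, n m i @[m --> \oo] --> \oo.

Let XU m w := sample_union (fun i j => X m i j) w.

Lemma size_sample_union m w : size (XU m w) = m.
Proof.
rewrite /XU /sample_union size_allpairs_dep sumnE big_map big_enum/= -[RHS]sizeX.
by apply: eq_bigr => i _; rewrite size_enum_ord.
Qed.

Lemma big_sample_union (V : nmodType) (F : T -> V) m w :
  \sum_(x <- XU m w) F x = \sum_i \sum_j F (X m i j w).
Proof.
rewrite /XU /sample_union big_allpairs_dep big_enum/=.
by apply: eq_bigr => i _; rewrite big_enum.
Qed.

Lemma measurable_pooled_sum (phi : T -> R) m : measurable_fun [set: T] phi ->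
  measurable_fun [set: Omega] (fun w => \sum_(x <- XU m w) phi x : R).
Proof.
move=> mphi; under eq_fun do rewrite big_sample_union.
by do 2 (apply: measurable_sum => ?); exact: measurableT_comp.
Qed.

(* The pooled mean is the average of the block means with weights
   [n m i / m <= 1], so no joint independence between blocks is needed. *)
Lemma pooled_weak_law (phi : T -> R) :
  nu.-integrable setT (EFin \o phi) ->
  (\int[P]_w `|m%:R^-1 * \sum_(x <- XU m w) phi x - (\int[nu]_x phi x)%R|%:E)%E
    @[m --> \oo] --> (0 : \bar R)%E.
Proof.
move=> iphi; set c := (\int[nu]_x phi x)%R.
have mphi : measurable_fun [set: T] phi by exact/measurable_EFinP/(measurable_int nu).
have mblock m i : measurable_fun [set: Omega]
    (fun w => `|sample_mean phi (fun j => X m i j) w - c|%:E).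
  apply/measurable_EFinP; apply: measurableT_comp => //.
  by apply: measurable_funB => //; exact: measurable_sample_mean.
have block0 i : (\int[P]_w `|sample_mean phi (fun j => X m i j) w - c|%:E)%E
    @[m --> \oo] --> (0 : \bar R)%E.
  apply: ge0_cvge0 => [m|e e0]; first exact: integral_ge0.
  have [n0 law] := weak_law_L1 P iphi e0.
  have : \forall m \near \oo, (n0 <= n m i)%N.
    exact: (@sizeX_oo i [set l | (n0 <= l)%N] (nbhs_infty_ge n0)).
  by apply: filterS => m n0m; exact: law.
pose S m := (\sum_i \int[P]_w `|sample_mean phi (fun j => X m i j) w - c|%:E)%E.
have sum0 : S m @[m --> \oo] --> (0 : \bar R)%E.
  rewrite [X in _ --> X](_ : _ = \sum_(i < k) 0)%E; last by rewrite big1.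
  apply: (@cvg_nnesum _ _ _ R _ (index_enum _) (fun i m =>
    \int[P]_w `|sample_mean phi (fun j => X m i j) w - c|%:E)%E (fun=> 0%E)) => i _.
    by apply: nearW => m; exact: integral_ge0.
  exact: block0.
apply: (@squeeze_cvge _ _ _ R (cst 0%E) _ S) => //; last exact: cvg_cst.
near=> m; apply/andP; split; first exact: integral_ge0.
(* At [m = 0] the weights [n m i / m] are all 0 and do not sum to 1. *)
have m0 : 0 < m%:R :> R by rewrite ltr0n; near: m; exact: nbhs_infty_gt.
rewrite /S -ge0_integral_sum//.
apply: ge0_le_integral => //.
- apply/measurable_EFinP; apply: measurableT_comp => //.
  apply: measurable_funB => //; apply: measurable_funM => //.
  exact: measurable_pooled_sum.
- exact: emeasurable_sum.
move=> w _; rewrite sumEFin lee_fin.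
have -> : m%:R^-1 * \sum_(x <- XU m w) phi x - c =
    \sum_i (n m i)%:R / m%:R * (sample_mean phi (fun j => X m i j) w - c).
  under [RHS]eq_bigr do rewrite mulrBr.
  rewrite sumrB -!mulr_suml -natr_sum sizeX mulfV ?gt_eqF// mul1r; congr (_ - _).
  rewrite big_sample_union mulr_sumr; apply: eq_bigr => i _.
  (* For an empty block [n m i] cannot be cancelled, but its sum is empty and both sides vanish. *)
  rewrite /sample_mean; have [ni0|ni0] := eqVneq (n m i) 0%N.
    rewrite big1 ?mulr0 ?mul0r// => -[j jn]; exfalso.
    by move: jn; rewrite ni0.
  by field; rewrite pnatr_eq0 ni0 gt_eqF.
rewrite (le_trans (ler_norm_sum _ _ _))// ler_sum// => i _.
rewrite normrM ger0_norm ?divr_ge0// ler_piMl// ler_pdivrMr// mul1r ler_nat.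
by rewrite -[leqRHS](sizeX m) (bigD1 i)//= leq_addr.
Unshelve. all: by end_near. Qed.

End pooled.

(** * Convergence in probability: Markov's inequality, coordinates, quotients *)

Section in_probability.
Context (R : realType) (dO : measure_display) (Omega : measurableType dO).
Context (P : probability Omega R).

Lemma cvg_L1_in_probability (Z : nat -> Omega -> R) :
  (forall m, measurable_fun [set: Omega] (Z m)) -> (forall m w, 0 <= Z m w) ->
  (\int[P]_w (Z m w)%:E)%E @[m --> \oo] --> (0 : \bar R)%E ->
  forall eps, 0 < eps -> P [set w | eps <= Z m w] @[m --> \oo] --> (0 : \bar R)%E.
Proof.
move=> mZ Z0 Z_cvg eps eps0.
have cvg0 : (eps^-1%:E * \int[P]_w (Z m w)%:E)%E @[m --> \oo] --> (0 : \bar R)%E.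
  by rewrite -(mule0 eps^-1%:E); apply: cvgeZl.
apply: (@squeeze_cvge _ _ _ R (cst 0%E) _ _ _ _ _ cvg0); last exact: cvg_cst.
apply: nearW => m; rewrite measure_ge0/= lee_pdivlMl//.
have := @le_integral_comp_abse _ _ _ P setT measurableT (EFin \o Z m) eps id.
rewrite setTI; under [in X in _ -> _ -> _ -> _ -> _ -> X]eq_integral do
  rewrite /= ger0_norm//.
rewrite (_ : [set x | _] = [set w | eps <= Z m w]); last first.
  by apply/seteqP; split=> w /=; rewrite lee_fin ger0_norm.
by apply => //; exact/measurable_EFinP.
Qed.

Context (d : nat) (N : 'rV[R]_d -> R).
Hypothesis normN : is_norm N.

Lemma measurable_norm_ge (Y : Omega -> 'rV[R]_d) (H : 'rV[R]_d) eps :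
  (forall j, measurable_fun [set: Omega] (fun w => Y w 0 j)) ->
  measurable [set w | eps <= N (Y w - H)].
Proof.
move=> mY.
have mN : measurable_fun [set: Omega] (N \o (fun w => Y w - H)).
  apply: measurable_is_norm => // j; under eq_fun do rewrite !mxE.
  exact: measurable_funB.
have := mN measurableT _ (measurable_itv `[eps, +oo[).
by rewrite setTI; congr measurable; apply/seteqP; split=> w; rewrite /= in_itv/= andbT.
Qed.

(** The norm is at most a fixed linear combination of the absolute coordinates, so its L^1 error
    tends to 0 and Markov's inequality applies. *)
Lemma consistent_L1_coord (Y : nat -> Omega -> 'rV[R]_d) (H : 'rV[R]_d) :
  (forall m j, measurable_fun [set: Omega] (fun w => Y m w 0 j)) ->
  (forall j, (\int[P]_w `|Y m w 0 j - H 0 j|%:E)%E @[m --> \oo] --> (0 : \bar R)%E) ->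
  consistent P N Y H.
Proof.
move=> mY Y_cvg; apply: cvg_L1_in_probability => [m|m w|].
- apply: (measurable_is_norm normN (Y := fun w => Y m w - H)) => j.
  by under eq_fun do rewrite !mxE; exact: measurable_funB.
- exact: is_norm_ge0.
have mYH m j : measurable_fun [set: Omega] (fun w => `|Y m w 0 j - H 0 j|%:E).
  by apply/measurable_EFinP; apply: measurableT_comp => //; exact: measurable_funB.
pose S m := (\sum_(j < d) (N (delta_mx 0 j))%:E * \int[P]_w `|Y m w 0 j - H 0 j|%:E)%E.
apply: (@squeeze_cvge _ _ _ R (cst 0%E) _ S); last 2 first.
- exact: cvg_cst.
- rewrite [X in _ --> X](_ : _ = \sum_(j < d) 0)%E; last by rewrite big1.
  apply: (@cvg_nnesum _ _ _ R _ (index_enum _) (fun j m => (N (delta_mx 0 j))%:E *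
    \int[P]_w `|Y m w 0 j - H 0 j|%:E)%E (fun=> 0%E)) => j _.
    apply: nearW => m; rewrite mule_ge0 ?integral_ge0 ?lee_fin//; exact: is_norm_ge0.
  by rewrite -(mule0 (N (delta_mx 0 j))%:E); apply: cvgeZl.
apply: nearW => m; apply/andP; split.
  by apply: integral_ge0 => w _; rewrite lee_fin is_norm_ge0.
rewrite /S; under eq_bigr do rewrite -ge0_integralZl_EFin ?is_norm_ge0//.
rewrite -ge0_integral_sum//; last 2 first.
- by move=> j; exact: measurable_funeM.
- by move=> j w _; rewrite mule_ge0 ?lee_fin ?is_norm_ge0.
apply: ge0_le_integral => //.
- by move=> w _; rewrite lee_fin is_norm_ge0.
- apply/measurable_EFinP; apply: (measurable_is_norm normN (Y := fun w => Y m w - H)) => j.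
  by under eq_fun do rewrite !mxE; exact: measurable_funB.
- by apply: emeasurable_sum => j; exact: measurable_funeM.
- move=> w _; under eq_bigr do rewrite -EFinM; rewrite sumEFin lee_fin.
  rewrite (le_trans (is_norm_le_coord normN _))// ler_sum// => j _.
  by rewrite !mxE mulrC.
Qed.

(** A Slutsky argument: the error of the quotient is [B^-1] times [A - H] plus [(1 - B)] times [H],
    which is small off two events of vanishing probability. *)
Lemma consistent_div (A : nat -> Omega -> 'rV[R]_d) (B : nat -> Omega -> R)
    (H : 'rV[R]_d) :
  (forall m j, measurable_fun [set: Omega] (fun w => A m w 0 j)) ->
  (forall m, measurable_fun [set: Omega] (B m)) ->
  consistent P N A H ->
  (forall eps, 0 < eps -> P [set w | eps <= `|B m w - 1|] @[m --> \oo] --> (0 : \bar R)%E) ->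
  consistent P N (fun m w => (B m w)^-1 *: A m w) H.
Proof.
move=> mA mB cA cB eps eps0.
have H0 := is_norm_ge0 normN H.
(* The 1/2 in [e2] keeps [B] above 1/2, so it suffices that the numerator stays below [eps / 2]:
   [e1] bounds the part from [A - H] by [eps / 4], and [e2] the part from [H] likewise. The 1 added
   to [N H] covers [H = 0]. *)
pose e1 := eps / 4.
pose e2 := Num.min (1 / 2) (eps / (4 * (N H + 1))).
have e10 : 0 < e1 by rewrite divr_gt0.
have e20 : 0 < e2 by rewrite lt_min !divr_gt0// mulr_gt0// ltr_wpDl.
have cAB : (P [set w | e1 <= N (A m w - H)]%R + P [set w | e2 <= `|B m w - 1|]%R)%E
    @[m --> \oo] --> (0 : \bar R)%E.
  by rewrite -[X in _ --> X]adde0; apply: cvgeD => //; [exact: cA|exact: cB].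
apply: (@squeeze_cvge _ _ _ R (cst 0%E) _ _ _ _ _ cAB); last exact: cvg_cst.
apply: nearW => m; rewrite measure_ge0/=.
have mB2 : measurable [set w | e2 <= `|B m w - 1|].
  have mN : measurable_fun [set: Omega] (fun w => `|B m w - 1|).
    by apply: measurableT_comp => //; exact: measurable_funB.
  have := mN measurableT _ (measurable_itv `[e2, +oo[).
  by rewrite setTI; congr measurable; apply/seteqP; split=> w; rewrite /= in_itv/= andbT.
have mA1 : measurable [set w | e1 <= N (A m w - H)] by exact: measurable_norm_ge.
apply: le_trans (measureU2 _ mA1 mB2).
apply: le_measure; rewrite ?inE.
- apply: measurable_norm_ge => j; under eq_fun do rewrite mxE.
  by apply: measurable_funM => //; exact: (measurableT_comp (@measurable_invr R)).
- exact: measurableU.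
move=> w /=; apply: contraPP => /not_orP[/negP]; rewrite -ltNge => A1 /negP.
rewrite -ltNge lt_min => /andP[B1 B2]; apply/negP; rewrite -ltNge.
have b_gt : 1 / 2 < B m w by move: B1; rewrite ltr_norml => /andP[]; lra.
have b0 : 0 < B m w by lra.
have -> : (B m w)^-1 *: A m w - H =
    (B m w)^-1 *: ((A m w - H) + (1 - B m w) *: H).
  rewrite scalerDl scale1r scaleNr addrA subrK scalerBr scalerA mulVf ?gt_eqF//.
  by rewrite scale1r.
rewrite (is_norm_scale normN) ger0_norm ?invr_ge0 ?(ltW b0)// ltr_pdivrMl//.
rewrite (le_lt_trans (is_norm_triangle normN _ _))// (is_norm_scale normN) distrC.
have BH : `|B m w - 1| * N H <= eps / 4.
  apply: le_trans (ler_wpM2r H0 (ltW B2)) _.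
  have h1 : 0 < N H + 1 by rewrite ltr_wpDl.
  rewrite (_ : _ * N H = eps / 4 * (N H / (N H + 1))); last by field; rewrite gt_eqF.
  by rewrite ger_pMr ?divr_gt0// ler_pdivrMr// mul1r lerDl.
rewrite /e1 in A1; nra.
Qed.

End in_probability.

(** * Consistency of the two importance sampling estimators *)

Theorem theorem3 (R : realType)
  (dT : measure_display) (T : measurableType dT) (mu : {measure set T -> \bar R})
  (dO : measure_display) (Omega : measurableType dO) (P : probability Omega R)
  (d : nat) (N : 'rV[R]_d -> R) (f q : T -> R) (h : T -> 'rV[R]_d)
  (k : nat) (n : nat -> 'I_k -> nat)
  (X : forall (m : nat) (i : 'I_k), 'I_(n m i) -> {mfun Omega >-> T})
  (normN : is_norm N)
  (densf : is_density mu f) (densq : is_density mu q)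
  (meash : forall j : 'I_d, measurable_fun [set: T] (fun x => h x 0 j))
  (inth : (\int[mu]_x (f x * N (h x))%:E < +oo)%E)
  (iidX : forall (m : nat) (i : 'I_k), iid_from P mu q (X m i))
  (sizeX : forall m : nat, (\sum_(i < k) n m i)%N = m)
  (sizeX_oo : forall i : 'I_k, n m i @[m --> \oo] --> \oo) :
  let H : 'rV[R]_d := \row_j (\int[mu]_x (f x * h x 0 j))%R in
  let XU (m : nat) (w : Omega) : seq T := sample_union (fun i j => X m i j) w in
  ((forall x, f x *: h x != 0 -> 0 < q x) ->
    consistent P N (fun m w => importance_estimator f q h (XU m w)) H) /\
  ((forall x, 0 < f x -> 0 < q x) ->
    forall (c : R) (fu : T -> R), 0 < c -> (forall x, fu x = c * f x) ->
    consistent P N (fun m w => self_normalized_estimator fu q h (XU m w)) H).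
Proof.
move=> H XU.
have [mf f0 f1] := densf; have [mq q0 q1] := densq.
(* The block sizes at [m = 1] sum to 1, so some sample exists there; its distribution realizes the
   proposal law as a probability [nu] on [T]. *)
have [i0 n1i0] : exists i0, (0 < n 1%N i0)%N.
  apply/existsP; rewrite -[X in is_true X]negbK; apply/negP.
  rewrite negb_exists => /forallP n1; move: (sizeX 1%N).
  by rewrite big1// => i _; have := n1 i; rewrite -eqn0Ngt => /eqP.
pose nu : probability T R := distribution P (X 1%N i0 (Ordinal n1i0)).
have nuq A : measurable A -> nu A = (\int[mu]_(x in A) (q x)%:E)%E.
  exact: (iidX 1%N i0).2.
have iidnu m i : iid_sample P nu (X m i).
  by split; [exact: (iidX m i).1|move=> j A mA; rewrite nuq// (iidX m i).2].
have size_XU m w : size (XU m w) = m by exact: size_sample_union.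
(* Used twice: with [g] a coordinate of [h], and with [g = 1] for the normalizing factor. *)
have coord_law (g : T -> R) : measurable_fun [set: T] g ->
    mu.-integrable setT (fun x => (f x * g x)%:E) ->
    (forall x, f x * g x != 0 -> 0 < q x) ->
    (\int[P]_w `|m%:R^-1 * \sum_(x <- XU m w) importance_weight f q x * g x
       - (\int[mu]_x (f x * g x))%R|%:E)%E @[m --> \oo] --> (0 : \bar R)%E.
  move=> mg ifg fgq.
  have [iw <-] := importance_weight_integral mq q0 nuq mf mg ifg fgq.
  exact: (pooled_weak_law iidnu sizeX sizeX_oo iw).
have mw : measurable_fun [set: T] (importance_weight f q).
  by apply: measurable_funM => //; exact: (measurableT_comp (@measurable_invr R)).
have IS_coord m w j : importance_estimator f q h (XU m w) 0 j =
    m%:R^-1 * \sum_(x <- XU m w) importance_weight f q x * h x 0 j.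
  rewrite /importance_estimator mxE size_XU summxE; congr (_ * _).
  by apply: eq_bigr => x _; rewrite mxE.
have mIS m j : measurable_fun [set: Omega]
    (fun w => importance_estimator f q h (XU m w) 0 j).
  under eq_fun do rewrite IS_coord; apply: measurable_funM => //.
  by apply: measurable_pooled_sum; exact: measurable_funM.
(* Integrability is assumed for the norm [N]; its equivalence with the sup norm passes it to each
   coordinate. *)
have ifh j : mu.-integrable setT (fun x => (f x * h x 0 j)%:E).
  have [C C0 NC] := sup_le_is_norm normN.
  have iN : mu.-integrable setT (fun x => (f x * N (h x))%:E).
    apply/integrableP; split.
      by apply/measurable_EFinP/measurable_funM => //; exact: (measurable_is_norm normN).
    under eq_integral => x _ do rewrite /= ger0_norm ?mulr_ge0 ?is_norm_ge0//.
    exact: inth.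
  apply: (le_integrable measurableT _ _ (integrableZl measurableT C iN)) => //.
    exact/measurable_EFinP/measurable_funM.
  move=> x _; rewrite -EFinM lee_fin !normrM (ger0_norm (f0 x)) mulrCA.
  rewrite ler_wpM2l// (le_trans (coord_le_norm _ _))// (le_trans (NC _))//.
  by rewrite ger0_norm ?(ltW C0)// ger0_norm// is_norm_ge0.
have IS_consistent : (forall x, f x *: h x != 0 -> 0 < q x) ->
    consistent P N (fun m w => importance_estimator f q h (XU m w)) H.
  move=> fhq; apply: consistent_L1_coord => // j.
  under eq_cvg => m do under eq_integral => w _ do rewrite IS_coord mxE.
  apply: coord_law => // x fhx; apply: fhq; apply: contraNneq fhx => fh0.
  by have /rowP/(_ j) := fh0; rewrite !mxE => ->.
split=> // fq c fu c0 fuE.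
pose B m w := m%:R^-1 * \sum_(x <- XU m w) importance_weight f q x.
have mB m : measurable_fun [set: Omega] (B m).
  by apply: measurable_funM => //; exact: measurable_pooled_sum.
have B_law : (\int[P]_w `|B m w - 1|%:E)%E @[m --> \oo] --> (0 : \bar R)%E.
  have int1 : (\int[mu]_x (f x * cst 1 x))%R = 1.
    by rewrite /Rintegral; under eq_integral do rewrite mulr1; rewrite f1.
  rewrite -{1}int1; under eq_cvg => m.
    under eq_integral => w _.
      rewrite /B; under eq_bigr => x _ do
        rewrite -[importance_weight _ _ _]mulr1 -[1]/(cst 1 x).
      over.
    over.
  apply: coord_law => //.
    apply/integrableP; split; first exact/measurable_EFinP/measurable_funM.
    by under eq_integral do rewrite /= mulr1 ger0_norm//; rewrite f1 ltry.
  by move=> x; rewrite mulr1 => fx; apply: fq; rewrite lt_neqAle eq_sym fx f0.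
(* The unknown constant [c] and the factor [1 / m] both cancel in the quotient. *)
have S_eq m w : self_normalized_estimator fu q h (XU m w) =
    (B m w)^-1 *: importance_estimator f q h (XU m w).
  have weightE x : importance_weight fu q x = c * importance_weight f q x.
    by rewrite /importance_weight fuE mulrA.
  rewrite /self_normalized_estimator /importance_estimator /weight_sum size_XU /B.
  rewrite (eq_bigr _ (fun x _ => weightE x)) -mulr_sumr.
  have -> : \sum_(x <- XU m w) importance_weight fu q x *: h x =
      c *: \sum_(x <- XU m w) importance_weight f q x *: h x.
    by rewrite scaler_sumr; apply: eq_bigr => x _; rewrite weightE scalerA.
  rewrite scalerA mulf_eq0 gt_eqF//=.
  (* With total weight 0 the default value 0 of the estimator agrees with [0^-1 = 0]. A nonzero
     total weight rules out [m = 0], where the sample is empty. *)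
  have [->|W0] := eqVneq (\sum_(x <- XU m w) importance_weight f q x) 0.
    by rewrite mulr0 invr0 scale0r.
  rewrite scalerA; case: m w W0 => [|m] w W0.
    have /size0nil XU0 := size_XU 0%N w.
    by move: W0; rewrite XU0 big_nil eqxx.
  congr (_ *: _); field.
  by rewrite W0 (gt_eqF c0) nat1r pnatr_eq0.
have -> : (fun m w => self_normalized_estimator fu q h (XU m w)) =
    (fun m w => (B m w)^-1 *: importance_estimator f q h (XU m w)).
  by apply/funext => m; apply/funext => w; exact: S_eq.
apply: consistent_div => //.
  apply: IS_consistent => x fhx; apply: fq; rewrite lt_neqAle f0 andbT.
  by apply: contraNneq fhx => <-; rewrite scale0r.
apply: cvg_L1_in_probability => // m.
by apply: measurableT_comp => //; exact: measurable_funB.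
Qed.
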